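(* Let $m\ge 1$ and $k\ge 1$ be integers such that every prime factor of $m$ is greater than $k^k$. Then any subset $S$ of size $k$ of $\mathrm{Dic}_{m}\setminus\{0\}$ is sequenceable.
   Context: Groups are written additively even when they are not abelian, and $0$ denotes the identity element. $\mathrm{Dic}_m$ is the dicyclic group of order $4m$, generated by two elements $s$ and $r$ subject to the relations $r+s=s-r$, $4s=0$, and $2s=mr$. A finite subset $S$ of size $k$ of a group is sequenceable if there is an ordering $(x_1,\dots,x_k)$ of its elements such that the partial sums $(s_0,s_1,\dots,s_k)$, given by $s_0=0$ and $s_i=x_1+x_2+\dots+x_i$ (summed in this order) for $1\le i\le k$, are pairwise distinct, with the possible exception that $s_k=s_0=0$ is allowed. *)

(* Defs.v *)
From HB Require Import structures.
From mathcomp Require Import all_boot all_order all_algebra all_fingroup.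
From mathcomp Require Import all_solvable.

Set Implicit Arguments.
Unset Strict Implicit.
Unset Printing Implicit Defensive.

Import GRing.Theory.
Local Open Scope group_scope.

(* MathComp groups are multiplicative: [x * y], [1], [x^-1], [x ^+ n] stand for
   the mathematical x + y, 0, -x, n x.

   [G \isog Grp (...)] says that G is isomorphic to the largest finite quotient
   of the presented group; here for m >= 1 the presented group is finite, of order
   4 m (dicyclic_card, dicyclic_exists). *)
Definition dicyclic (m : nat) (gT : finGroupType) (G : {set gT}) : Prop :=
  G \isog Grp (s : r : (r * s = s * r^-1, s ^+ 4 = 1, s ^+ 2 = r ^+ m)).

Definition partial_prod (gT : finGroupType) (t : seq gT) (i : nat) : gT :=
  \prod_(x <- take i t) x.

Definition sequenceable (gT : finGroupType) (S : {set gT}) : Prop :=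
  exists t : seq gT,
    [/\ uniq t, t =i S
      & forall i j : nat, i < j <= size t -> (i, j) != (0, size t) ->
          partial_prod t i <> partial_prod t j].

(* A model of the presentation: (i, a) stands for r ^+ i * s ^+ a. *)
Definition dic_model (m : nat) : Type := ('Z_(m.*2) * bool)%type.

HB.instance Definition _ (m : nat) :=
  Finite.copy (dic_model m) ('Z_(m.*2) * bool)%type.

Section DicModel.

Variable m : nat.
Local Notation D := (dic_model m).

Let c : 'Z_(m.*2) := (m%:R)%R.

Let c2 : (c + c = 0)%R.
Proof.
case: (posnP m) => [m0|m_gt0]; first by rewrite /c m0 addr0.
by rewrite /c -natrD addnn pchar_Zp // -addnn; case: (m) m_gt0 => // n _; rewrite addnS.
Qed.

Definition dic_mul (x y : D) : D :=
  ((x.1 + (if x.2 then - y.1 else y.1)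
        + (if x.2 && y.2 then (m%:R : 'Z_(m.*2)) else 0))%R, x.2 (+) y.2).
Definition dic_one : D := (0%R, false).
Definition dic_inv (x : D) : D :=
  if x.2 then ((x.1 + (m%:R : 'Z_(m.*2)))%R, true) else ((- x.1)%R, false).

Let cN : (- c = c)%R.
Proof. by apply/eqP; rewrite -subr_eq0 -opprD c2 oppr0. Qed.

Fact dic_mulA : associative dic_mul.
Proof.
move=> [i [|]] [j [|]] [k [|]]; rewrite /dic_mul /= -/c; congr pair;
  rewrite ?addr0 ?opprD ?opprK ?cN !addrA //;
  exact: addrAC.
Qed.

Fact dic_mul1 : left_id dic_one dic_mul.
Proof. by move=> [i a]; rewrite /dic_mul /= add0r addr0. Qed.

Fact dic_mulV : left_inverse dic_one dic_inv dic_mul.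
Proof.
move=> [i [|]]; rewrite /dic_mul /dic_inv /dic_one /= -/c; congr pair.
  by rewrite addrAC -(addrA i) c2 addr0 subrr.
by rewrite addNr addr0.
Qed.

HB.instance Definition _ := Finite_isGroup.Build D dic_mulA dic_mul1 dic_mulV.

End DicModel.

Lemma dic_model_card m : 0 < m -> #|[set: dic_model m]| = (4 * m)%N.
Proof.
move=> m_gt0; rewrite cardsT card_prod card_bool card_ord Zp_cast; last first.
  by rewrite -addnn; case: (m) m_gt0 => // n _; rewrite addnS.
by rewrite -muln2 -mulnA mulnC.
Qed.

Lemma dic_model_dicyclic m : 0 < m -> dicyclic m [set: dic_model m].
Proof.
move=> m_gt0; have m2_gt1: 1 < m.*2.
  by rewrite -addnn; case: (m) m_gt0 => // n _; rewrite addnS.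
pose r : dic_model m := (1%R, false); pose s : dic_model m := (0%R, true).
have mulE (x y : dic_model m) : x * y = dic_mul x y by [].
have rX i : r ^+ i = (i%:R%R, false) :> dic_model m.
  elim: i => [|i IHi] //.
  by rewrite expgS IHi mulE /dic_mul /= addr0 mulrS.
have rsE (x : dic_model m) : x = r ^+ x.1 * s ^+ x.2.
  case: x => i [|]; rewrite rX /= ?expg0 ?expg1 ?mulg1 natr_Zp //.
  by rewrite mulE /dic_mul /= !addr0.
have rs : r * s = s * r^-1.
  by rewrite mulE [RHS]mulE /dic_mul /= opprK !addr0 add0r.
have s2 : s ^+ 2 = r ^+ m.
  by rewrite rX expgS expg1 mulE /dic_mul /= subr0 add0r.
have s4 : s ^+ 4 = 1.
  by rewrite (expgnA s 2 2) s2 -expgnA muln2 rX pchar_Zp.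
have genD : <[s]> <*> <[r]> = [set: dic_model m].
  apply/eqP; rewrite eqEsubset subsetT; apply/subsetP=> x _; rewrite (rsE x).
  by rewrite groupM // groupX // mem_gen // inE ?cycle_id ?orbT.
apply: intro_isoGrp => [|rT H].
  by apply/existsP; exists (s, r); apply/eqP; congr (_, (_, (_, _))).
case/existsP=> -[s' r'] /= /eqP[defH rs' s4' s2'].
have r2m : r' ^+ m.*2 = 1 by rewrite -muln2 expgnA -s2' -expgnA.
have rXs i : s' * r' ^+ i = r' ^- i * s'.
  have sr : s' * r' = r'^-1 * s'.
    by apply: (mulgI r'); rewrite mulgA rs' mulgKV mulKVg.
  elim: i => [|i IHi]; first by rewrite invg1 mul1g mulg1.
  by rewrite expgSr mulgA IHi -mulgA sr mulgA -invMg -expgS expgSr.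
have rD (i j : 'Z_(m.*2)) : r' ^+ (i + j)%R = r' ^+ i * r' ^+ j.
  by rewrite /= expg_mod ?expgD // Zp_cast.
have rN (i : 'Z_(m.*2)) : r' ^+ (- i)%R = r' ^- i.
  by apply: (mulgI (r' ^+ i)); rewrite -rD subrr mulgV.
have rm : r' ^+ (m%:R : 'Z_(m.*2))%R = r' ^+ m.
  by rewrite val_Zp_nat // expg_mod.
pose f (x : dic_model m) := r' ^+ x.1 * s' ^+ x.2.
have fE i a : f (i, a) = r' ^+ i * s' ^+ a by [].
have fM : {in [set: dic_model m] &, {morph f : x y / x * y}}.
  move=> [i a] [j b] _ _.
  rewrite mulE /dic_mul !fE !rD -!mulgA; congr (_ * _).
  case: a b => [] [] //; rewrite ?rN ?rm ?expg0 ?expg1 ?mulg1 ?mul1g //.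
  by rewrite mulgA rXs -mulgA -s2' expgS expg1.
apply/homgP; exists (Morphism fM); rewrite morphimEdom -defH.
apply/eqP; rewrite eqEsubset; apply/andP; split.
  apply/subsetP=> _ /imsetP[x _ ->]; rewrite /= /f.
  by rewrite groupM // groupX // mem_gen // inE ?cycle_id ?orbT.
have im_group : group_set (f @: setT).
  by rewrite -(morphimEdom (Morphism fM)) groupP.
rewrite join_subG !cycle_subG /= -[_ @: _]/(gval (Group im_group)).
apply/andP; split; apply/imsetP; [exists s | exists r] => //; rewrite /f /=.
  by rewrite mul1g expg1.
by rewrite mulg1 modn_small // Zp_cast.
Qed.

Lemma dicyclic_exists m : 0 < m ->
  exists (gT : finGroupType) (G : {group gT}), dicyclic m G.
Proof.
move=> m_gt0; exists (dic_model m), [set: dic_model m]%G.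
exact: dic_model_dicyclic.
Qed.

Lemma dicyclic_card m (gT : finGroupType) (G : {group gT}) :
  0 < m -> dicyclic m G -> #|G| = (4 * m)%N.
Proof.
move=> m_gt0 dicG; rewrite -(dic_model_card m_gt0); apply: card_isog.
have dicD := dic_model_dicyclic m_gt0.
rewrite isogEhom (dicD _ G) (dicG _ [set: dic_model m]%G).
by rewrite !isoGrp_hom.
Qed.

(* Main.v *)
Require Import Defs.
From mathcomp Require Import all_boot all_order all_algebra all_fingroup.
From mathcomp Require Import zify.

Set Implicit Arguments.
Unset Strict Implicit.
Unset Printing Implicit Defensive.

Import Order.TTheory GRing.Theory Num.Theory.
Local Open Scope ring_scope.

(** Why the theorem holds.  The case [k = 1] is immediate, and for [k >= 2] the
hypothesis forces [m] to be odd, so that [Dic_m] is the semidirect product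
[Z/m : Z/4] in which the odd classes of [Z/4] act by negation.

Rectification ([dilation]).  Dirichlet's box principle applied to the
[k ^ k + 1] multipliers [0, ..., k ^ k] gives one multiplier, a unit modulo [m]
because it is smaller than every prime factor of [m], that sends the [Z/m]
coordinates of the [k] elements of [S] to residues represented by integers of
absolute value less than [m / k].  A signed sum of at most [k] of these integers
has absolute value less than [m], hence vanishes as soon as it vanishes modulo
[m] ([zprod_bound]).  So an ordering that works for the lifted elements of
[Z : Z/4] works for [S]; the relation [lifts] transports the products.

It remains to order a finite set of nonidentity elements of [Z : Z/4]
([zdic_sequenceable]).  Call the elements with odd second coordinate flips: after
each of them the integer coordinates of the next elements are counted with the
opposite sign.  The other elements are positive, negative, or equal to the central
involution [ztwo], which leaves the integer coordinate unchanged.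

With at least one flip, the partial products of even and of odd class never
collide with each other, and one arranges that both families strictly rise: the
positive elements come first, the negative ones just after the first flip, where
they count as increments, and the values of the flips alternate strictly between
high and low ([rises], [rising_distinct]).  A reflection turns a low-high alternation
into a high-low one ([falling_distinct]).  Three or more flips can always be
alternated, because at most two of them share a value ([zigzag_exists]); two
flips of the same value are separated by a positive or negative element, and
when there is none the set has at most three elements ([flips_sequenceable]).

Without flips everything commutes: all positive elements come first, then
[ztwo] if present, then all negative ones, so a collision is an equality between
a sum over the positive elements next to the peak and a sum over the negative
ones next to it.  [peak_order] excludes these by removing elements from the far
ends: on the side with the larger total at most one element has a removal that
makes the two totals agree ([nonflips_sequenceable]). *)

(** * The group of pairs in Z : Z/4 *)

Notation zdic := (int * 'Z_4)%type.

(** The law of the semidirect product of the integers by [Z/4], where odd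
    classes act by negation: the infinite cover of the dicyclic groups. *)
Definition zmul (p x : zdic) : zdic :=
  (p.1 + (if odd p.2 then - x.1 else x.1), p.2 + x.2).

Arguments zmul : simpl never.

Definition zprod (p : zdic) (t : seq zdic) : zdic := foldl zmul p t.

Definition zsum (s : seq zdic) : zdic := \sum_(x <- s) x.

Lemma zsum0 : zsum [::] = 0.
Proof. exact: big_nil. Qed.

Lemma zsum_cons x s : zsum (x :: s) = x + zsum s.
Proof. exact: big_cons. Qed.

Lemma zsum_cat s t : zsum (s ++ t) = zsum s + zsum t.
Proof. exact: big_cat. Qed.

Lemma perm_zsum s t : perm_eq s t -> zsum s = zsum t.
Proof. exact: perm_big. Qed.

Lemma zsum_rev s : zsum (rev s) = zsum s.
Proof. by apply: perm_zsum; rewrite perm_rev. Qed.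

Lemma zsum_cons1 x s : (zsum (x :: s)).1 = x.1 + (zsum s).1.
Proof. by rewrite zsum_cons. Qed.

Definition distinct_prods (t : seq zdic) : Prop :=
  forall i j, (i < j <= size t)%N -> (i, j) != (0%N, size t) ->
    zprod 0 (take i t) <> zprod 0 (take j t).

Definition flip (x : zdic) := odd x.2.

Lemma odd_Z4D (a b : 'Z_4) : odd (a + b)%R = odd a (+) odd b.
Proof. by rewrite /= odd_mod // oddD. Qed.

Lemma odd_Z4P (a : 'Z_4) : odd a -> a = 1 \/ a = 3%:R.
Proof. by case: a => [[|[|[|[|]]]] //= i] _; [left | right]; apply: val_inj. Qed.

Lemma even_Z4P (a : 'Z_4) : ~~ odd a -> a = 0 \/ a = 2%:R.
Proof. by case: a => [[|[|[|[|]]]] //= i] _; [left | right]; apply: val_inj. Qed.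

(** * Reflection *)

Definition zneg (x : zdic) : zdic := (- x.1, x.2).

Lemma zprod_neg p t : zprod (zneg p) (map zneg t) = zneg (zprod p t).
Proof.
elim: t p => //= x t IHt p; rewrite -IHt; congr (zprod _ _).
by rewrite /zmul /zneg /= opprD; case: ifP.
Qed.

Lemma distinct_prods_neg t : distinct_prods (map zneg t) -> distinct_prods t.
Proof.
move=> gt i j lij nij eqij; apply: (gt i j); rewrite ?size_map //.
have E k : zprod 0 (take k (map zneg t)) = zneg (zprod 0 (take k t)).
  by rewrite -map_take -zprod_neg.
by rewrite !E eqij.
Qed.

(** * Strictly rising partial products *)

(** The products along [t] are followed through the parity [b] of the current
    class and the threshold [w]: the next product of the other parity exceeds the
    previous one of that parity exactly when the value of the next flip is above
    [w] (for even [b]) or below [w] (for odd [b]).  Hence [w] is the value of the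
    last flip, lowered by the values of the elements placed since. *)
Fixpoint rises (b : bool) (w : int) (t : seq zdic) : bool :=
  if t is x :: t' then
    if flip x then
      (if b then x.1 < w else w < x.1) && rises (~~ b) x.1 t'
    else (if b then x.1 < 0 else 0 < x.1) && rises b (w - x.1) t'
  else true.

(** Both parities rise: a later product is above the current one if it has the
    same parity, and otherwise above the last product of the other parity, which
    the threshold encodes. *)
Lemma rises_gt b w t p k : rises b w t -> flip p = b -> (0 < k <= size t)%N ->
  let q := zprod p (take k t) in
  (if flip q == b then p.1 else if b then p.1 - w else p.1 + w) < q.1.
Proof.
elim: t b w p k => [|x t IHt] b w p [|k] //= r pb lk.
have fp : flip (zmul p x) = flip p (+) flip x by rewrite /flip odd_Z4D.
have p1 : (zmul p x).1 = p.1 + (if b then - x.1 else x.1) by rewrite -pb.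
have {r} [xc r] : (if flip x then if b then x.1 < w else w < x.1
                   else if b then x.1 < 0 else 0 < x.1) /\
   rises (b (+) flip x) (if flip x then x.1 else w - x.1) t.
  by case: (flip x) r => /andP[]; rewrite ?addbT ?addbF.
case: k lk => [_|k lk].
  rewrite take0 /= fp -/(flip p) pb.
  by case: (flip x) xc; case: b {pb p1 fp r} => /=; lia.
have := IHt _ _ (zmul p x) k.+1 r; rewrite fp pb => /(_ erefl lk) /=.
rewrite -/(flip p) pb; set q := zprod _ _; move: xc.
by case: (flip x); case: (flip q); case: b {pb p1 fp r} => /=; lia.
Qed.

Lemma rises_distinct b w t p i j : rises b w t -> flip p = b ->
  (i < j <= size t)%N -> zprod p (take i t) <> zprod p (take j t).
Proof.
elim: t b w p i j => [|x t IHt] b w p i j.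
  by move=> _ _; case: j => [|j]; rewrite ?ltn0 ?andbF.
case: i => [|i] r pb lij.
  move=> eqp; have := rises_gt (k := j) r pb lij.
  by rewrite -eqp take0 /zprod; cbv zeta; rewrite [foldl _ _ _]/= pb eqxx ltxx.
case: j lij => // j lij /=.
have fp : flip (zmul p x) = flip p (+) flip x by rewrite /flip odd_Z4D.
apply: (IHt (b (+) flip x) (if flip x then x.1 else w - x.1)) => //.
  by move: r => /=; case: (flip x) => /andP[]; rewrite ?addbT ?addbF.
by rewrite fp pb.
Qed.

Definition nonflip_pos (x : zdic) := ~~ flip x && (0 < x.1).
Definition nonflip_neg (x : zdic) := ~~ flip x && (x.1 < 0).

Lemma rises_cat_pos w P t : all nonflip_pos P ->
  rises false w (P ++ t) = rises false (w - (zsum P).1) t.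
Proof.
elim: P w => [|x P IHP] w /=; first by rewrite zsum0 subr0.
by case/andP=> /andP[/negbTE-> ->] /= /IHP ->; rewrite zsum_cons1 opprD addrA.
Qed.

Lemma rises_cat_neg w N t : all nonflip_neg N ->
  rises true w (N ++ t) = rises true (w - (zsum N).1) t.
Proof.
elim: N w => [|x P IHP] w /=; first by rewrite zsum0 subr0.
by case/andP=> /andP[/negbTE-> ->] /= /IHP ->; rewrite zsum_cons1 opprD addrA.
Qed.

(** The central involution. *)
Definition ztwo : zdic := (0, 2%:R).

Lemma zsum_neg_le0 N : all nonflip_neg N -> (zsum N).1 <= 0.
Proof.
elim: N => [|x N IHN] /=; first by rewrite zsum0.
by case/andP=> /andP[_ x0] /IHN; rewrite zsum_cons1; lia.
Qed.

(** After the optional involution, the positive elements raise the even products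
    and the negative ones, placed in the odd regime, raise the odd products; the
    flips of [F] then continue the rise. *)
Lemma rising_distinct n P N f F :
  (n <= 1)%N -> all nonflip_pos P -> all nonflip_neg N -> flip f ->
  rises true (f.1 - (zsum N).1) F ->
  distinct_prods (nseq n ztwo ++ P ++ f :: N ++ F).
Proof.
move=> n1 Ppos Nneg ff r; set t := P ++ _.
(* There is no earlier product of odd class: any threshold below the value that
   the first flip reaches will do. *)
have rt : rises false ((zsum P).1 + f.1 - 1) t.
  rewrite rises_cat_pos //= ff /= rises_cat_neg // r andbT.
  by lia.
case: n n1 => [|[|//]] _ i j lij _; first exact: (rises_distinct rt).
case: j lij => [|j]; first by rewrite andbC.
have e0 : zmul 0 ztwo = ztwo by rewrite /zmul /= !add0r.
(* A leading involution keeps the integer coordinate at 0, and all later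
   products of even class are above it. *)
case: i => [|i] lij; last by rewrite /= e0; apply: (rises_distinct rt).
rewrite /= e0; case: j lij => [|j] lij /=; first by rewrite take0.
move=> eq0; have := rises_gt (p := ztwo) (k := j.+1) rt erefl lij.
by rewrite /= -eq0.
Qed.

Lemma rises_neg b w F : all flip F ->
  rises b w (map zneg F) = rises (~~ b) (- w) F.
Proof.
elim: F b w => //= x F IHF b w /andP[fx fF].
rewrite fx {1}/flip /= -/(flip x) fx IHF //= opprK; congr andb.
by case: b => /=; apply/idP/idP; lia.
Qed.

Lemma zsum_zneg s : (zsum (map zneg s)).1 = - (zsum s).1.
Proof.
elim: s => [|x s IHs]; first by rewrite !zsum0.
by rewrite !zsum_cons1 IHs opprD.
Qed.

Lemma rises_weaken b w w' F : all flip F -> (if b then w <= w' else w' <= w) ->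
  rises b w F -> rises b w' F.
Proof.
case: F => //= x F /andP[-> _] ww' /andP[xw ->].
by case: b ww' xw => /= ww' xw; rewrite andbT; lia.
Qed.

Lemma all_nonflip_neg P : all nonflip_neg (map zneg P) = all nonflip_pos P.
Proof.
rewrite all_map; apply: eq_all => x.
by rewrite /= /nonflip_neg /= oppr_lt0.
Qed.

Lemma all_nonflip_pos P : all nonflip_pos (map zneg P) = all nonflip_neg P.
Proof.
rewrite all_map; apply: eq_all => x.
by rewrite /= /nonflip_pos /= oppr_gt0.
Qed.

(** The mirror image of [rising_distinct] under [zneg]. *)
Lemma falling_distinct n P N f F :
  (n <= 1)%N -> all nonflip_pos P -> all nonflip_neg N -> all flip (f :: F) ->
  rises false (f.1 - (zsum P).1) F ->
  distinct_prods (nseq n ztwo ++ N ++ f :: P ++ F).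
Proof.
move=> n1 Ppos Nneg /= /andP[ff fF] r; apply: distinct_prods_neg.
rewrite map_cat map_nseq map_cat /= map_cat.
have -> : zneg ztwo = ztwo by [].
apply: rising_distinct; rewrite ?all_nonflip_pos ?all_nonflip_neg //.
by rewrite zsum_zneg rises_neg //= opprB opprK addrC.
Qed.

(** * Alternating the flips *)

Definition zigzag b (F : seq zdic) :=
  if F is f :: F' then rises b f.1 F' else true.

(** The second coordinate of a flip is 1 or 3, so a value occurs at most twice. *)
Lemma flip_thrice (x y z : zdic) : flip x -> flip y -> flip z ->
  uniq [:: x; y; z] -> x.1 = y.1 -> y.1 != z.1.
Proof.
case: x y z => [x a] [y b] [z c]; rewrite /flip /= !inE => fa fb fc u exy.
apply/eqP=> eyz; move: u; rewrite exy eyz !xpair_eqE !eqxx /=.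
by case: (odd_Z4P fa) => ->; case: (odd_Z4P fb) => ->; case: (odd_Z4P fc) => ->.
Qed.

Lemma ex_extremes (F : seq zdic) : (1 < size F)%N ->
  exists (a c : zdic) (B : seq zdic), perm_eq F (a :: c :: B) /\
    all (fun x : zdic => a.1 <= x.1 <= c.1) (a :: c :: B).
Proof.
move=> F2; pose le (x y : zdic) := x.1 <= y.1.
have letot : total le by move=> x y; apply: le_total.
have letr : transitive le by move=> x y z; apply: le_trans.
have pF : perm_eq F (sort le F) by rewrite perm_sym perm_sort.
have sF : sorted le (sort le F) by apply: sort_sorted.
move: (sort le F) pF sF => [|a s] pF sF; first by rewrite (perm_size pF) in F2.
case/lastP: s pF sF => [|B c] pF sF; first by rewrite (perm_size pF) in F2.
exists a, c, B; split.
  by rewrite (perm_trans pF) // perm_cons perm_rcons.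
have ac : all (le a) (rcons B c) by apply: order_path_min sF.
have Bc x : x \in a :: B -> le x c.
  have: pairwise le (rcons (a :: B) c) by rewrite -(sorted_pairwise letr).
  by rewrite pairwise_rcons => /andP[/allP h _] /h.
move: ac; rewrite all_rcons => /andP[lac /allP aB].
rewrite /= !lexx (lac : a.1 <= c.1) /=.
by apply/allP=> x xB; apply/andP; split; [exact: aB | apply: Bc; rewrite inE xB orbT].
Qed.

(** Induction by two elements: the maximum [c] and the minimum [a] are put in front
    of an alternation of the others, in the order that fits its first step.
    Strictness is automatic once that alternation has two elements, since its
    first element is then strictly above or below another one.  The remaining
    cases have one or two other elements; their ties are broken because no value
    occurs three times. *)
Lemma zigzag_exists F : all flip F -> uniq F -> (2 < size F)%N ->
  exists b (F' : seq zdic), perm_eq F' F /\ zigzag b F'.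
Proof.
have [n] := ubnP (size F); elim: n F => // n IHn F ltFn fF uF F2.
have [a [c [B [pF]]]] := ex_extremes (ltnW F2).
rewrite (perm_all _ pF) in fF; rewrite (perm_uniq pF) in uF.
have sF := perm_size pF; rewrite /= in sF.
rewrite sF in ltFn F2.
have ppF s : perm_eq s (a :: c :: B) -> perm_eq s F.
  by move=> ps; rewrite perm_sym in pF; apply: perm_trans pF.
have acB s : perm_eq s B -> perm_eq (c :: a :: s) (a :: c :: B).
  by move=> ps; rewrite (perm_catCA [:: c] [:: a]) /= !perm_cons.
have caB s : perm_eq s B -> perm_eq (a :: c :: s) (a :: c :: B).
  by move=> ps; rewrite !perm_cons.
rewrite /= => /and3P[ac_ _ ac]; have /andP[_ a_c] := ac_.
move: fF => /= /and3P[fa fc fB].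
case: (ltnP 2 (size B)) => [B3|B2].
  have uB : uniq B by move: uF => /= /and3P[].
  have [|b [F' [pF' zF']]] := IHn B _ fB uB B3; first by lia.
  have acF' : all (fun x : zdic => a.1 <= x.1 <= c.1) F' by rewrite (perm_all _ pF').
  have fF' : all flip F' by rewrite (perm_all _ pF').
  have F'3 : (2 < size F')%N by rewrite (perm_size pF').
  case: F' pF' zF' acF' fF' F'3 => [|x [|y F']] // pF' /= zF' acF' fF' _.
  move: fF' zF' acF' => /and3P[fx fy _]; rewrite fy => /andP[xy zF'].
  case/and3P=> /andP[ax xc] /andP[ay yc] _.
  case: b xy zF' => xy zF'.
    exists true, (c :: a :: x :: y :: F'); split; first exact/ppF/acB.
    by rewrite /= fa fx fy zF' xy /=; clear -ax xc ay yc xy; lia.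
  exists false, (a :: c :: x :: y :: F'); split; first exact/ppF/caB.
  by rewrite /= fc fx fy zF' xy /=; clear -ax xc ay yc xy; lia.
have thrice x : x \in B -> a.1 = x.1 -> x.1 < c.1.
  move=> xB ax; have fx := allP fB _ xB; have /andP[_ xc] := allP ac _ xB.
  rewrite lt_neqAle xc andbT; apply: (flip_thrice fa fx fc) => //.
  move: uF; rewrite /= !inE !negb_or => /and3P[/andP[ac' aB] cB _].
  rewrite ac' (contraNneq _ aB) => [|->] //=.
  by rewrite (contraNneq _ cB) // => <-.
case: B pF sF ltFn F2 ppF acB caB uF ac fB thrice B2
  => [|x [|y [|//]]] // _ _ _ _ ppF acB caB uF /= + + thrice _.
  move=> /andP[/andP[ax xc] _] /andP[fx _].
  have [eax|nax] := eqVneq (a.1 : int) x.1.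
    exists false, [:: x; c; a]; split.
      by apply/ppF/seq.permP=> q /=; clear; lia.
    by rewrite /= fc fa /= andbT; move: (thrice x); rewrite inE eqxx => /(_ isT eax); lia.
  exists true, [:: x; a; c]; split.
    by apply/ppF/seq.permP=> q /=; clear; lia.
  have a_x : a.1 < x.1 by rewrite lt_neqAle nax.
  by rewrite /= fc fa /= a_x (lt_le_trans a_x xc).
move=> /and3P[/andP[ax xc] /andP[ay yc] _] /and3P[fx fy _].
have [lxy|lyx|exy] := ltgtP (x.1 : int) y.1.
- exists true, [:: c; a; y; x]; split; first by apply/ppF/seq.permP=> q /=; clear; lia.
  by rewrite /= fx fa fy /=; clear -ax xc ay yc lxy; lia.
- exists true, [:: c; a; x; y]; split; first by apply/ppF/seq.permP=> q /=; clear; lia.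
  by rewrite /= fx fa fy /=; clear -ax xc ay yc lyx; lia.
have uxy z : z \in [:: a; c] -> x.1 != z.1.
  move=> zac; rewrite exy; apply: (flip_thrice fx fy) => //.
    by move: zac; rewrite !inE => /orP[] /eqP->.
  move: uF; rewrite /= !inE !negb_or -!andbA => /and5P[_ axn ayn cxn /and3P[cyn -> _]] /=.
  move: zac; rewrite !inE => /orP[] /eqP->;
    by rewrite (eq_sym x) (eq_sym y) ?axn ?ayn ?cxn ?cyn.
have a_x : a.1 < x.1.
  by rewrite lt_neqAle ax andbT eq_sym uxy // inE eqxx.
have x_c : x.1 < c.1 by rewrite lt_neqAle xc andbT uxy // !inE eqxx orbT.
(* The tied values [x] and [y] go to the two ends. *)
exists true, [:: x; a; c; y]; split.
  by apply/ppF/seq.permP=> q /=; clear; lia.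
by rewrite /= fc fa fy /=; lia.
Qed.

(** * Sequencing a set that contains a flip *)

Lemma flips_sequenceable n (P N F : seq zdic) :
  (n <= 1)%N -> all nonflip_pos P -> all nonflip_neg N ->
  all flip F -> uniq F -> (0 < size F)%N ->
  exists t, perm_eq t (nseq n ztwo ++ P ++ N ++ F) /\ distinct_prods t.
Proof.
move=> n1 Ppos Nneg fF uF F0.
have rising f F' : perm_eq (f :: F') F -> rises true (f.1 - (zsum N).1) F' ->
    exists t, perm_eq t (nseq n ztwo ++ P ++ N ++ F) /\ distinct_prods t.
  move=> pF' r; exists (nseq n ztwo ++ P ++ f :: N ++ F'); split.
    by apply/seq.permP=> q; have := seq.permP pF' q;
      rewrite /= !count_cat /= !count_cat /=; lia.
  by apply: rising_distinct => //; move: fF; rewrite -(perm_all _ pF') => /andP[].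
have falling f F' : perm_eq (f :: F') F -> rises false (f.1 - (zsum P).1) F' ->
    exists t, perm_eq t (nseq n ztwo ++ P ++ N ++ F) /\ distinct_prods t.
  move=> pF' r; exists (nseq n ztwo ++ N ++ f :: P ++ F'); split.
    by apply/seq.permP=> q; have := seq.permP pF' q;
      rewrite /= !count_cat /= !count_cat /=; lia.
  by apply: falling_distinct => //; rewrite (perm_all _ pF').
have N0 := zsum_neg_le0 Nneg.
have P0 : 0 <= (zsum P).1.
  have := zsum_neg_le0 (N := map zneg P); rewrite all_nonflip_neg => /(_ Ppos).
  by rewrite zsum_zneg oppr_le0.
have weaken_rising f F' : all flip F' -> rises true f.1 F' ->
    rises true (f.1 - (zsum N).1) F'.
  by move=> fF' r; apply: rises_weaken r => //=; lia.
have weaken_falling f F' : all flip F' -> rises false f.1 F' ->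
    rises false (f.1 - (zsum P).1) F'.
  by move=> fF' r; apply: rises_weaken r => //=; lia.
case: (ltnP 2 (size F)) => [F3|].
  have [b [[|f F'] [pF' zF']]] := zigzag_exists fF uF F3.
    by move: F3; rewrite -(perm_size pF').
  have fF' : all flip F' by move: fF; rewrite -(perm_all _ pF') => /andP[].
  by case: b zF' => /= ?; [apply: rising pF' _ | apply: falling pF' _]; auto.
case: F fF uF F0 rising falling => [|f [|g [|//]]] //.
  by move=> _ _ _ rising _ _; apply: (rising f [::]).
rewrite /= !andbT => /andP[ff fg]; rewrite inE => nfg _ rising falling _.
have [fg1|gf1|efg] := ltgtP (f.1 : int) g.1.
- apply: (falling f [:: g]); rewrite //= fg /=; lia.
- apply: (rising f [:: g]); rewrite //= fg /=; lia.
(* The two flips have the same value: a negative element between them makes the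
   second step of the alternation strict, and so does a positive one in the
   reflected order. *)
case: N Nneg N0 rising falling weaken_rising => [|x N] Nneg N0 rising falling _; last first.
  apply: (rising f [:: g]); rewrite //= fg /= andbT zsum_cons1.
  by move: Nneg => /= /andP[/andP[_ x0] /zsum_neg_le0]; lia.
case: P Ppos P0 rising falling weaken_falling => [|x P] Ppos P0 rising falling _; last first.
  apply: (falling f [:: g]); rewrite //= fg /= andbT zsum_cons1.
  move: Ppos => /= /andP[/andP[_ x0]]; rewrite -all_nonflip_neg => /zsum_neg_le0.
  by rewrite zsum_zneg /=; lia.
(* Only the two flips and possibly the involution are left.  The two flips are
   mutually inverse: alone their product is the exempt total, and otherwise the
   involution separates them. *)
exists (f :: nseq n ztwo ++ [:: g]); split; first by rewrite -cat1s perm_catCA.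
move=> i j; case: f g ff fg nfg efg {N0 P0 rising falling} => [f1 f2] [g1 g2].
rewrite /flip /= => /odd_Z4P ff /odd_Z4P fg nfg efg; move: nfg; rewrite efg xpair_eqE eqxx /=.
by case: n n1 => [|[|]] // _; case: ff => ->; case: fg => -> //= _;
  case: i => [|[|[|i]]]; case: j => [|[|[|[|j]]]] //=;
  rewrite ?andbF // => _ _ /(congr1 snd) /(congr1 val).
Qed.

(** * Sequencing a set without flips *)

Lemma zsum_take_lt (s : seq zdic) i j : all (fun x : zdic => 0 < x.1) s ->
  (i < j <= size s)%N -> (zsum (take i s)).1 < (zsum (take j s)).1.
Proof.
elim: s i j => [|x s IHs] i j.
  by move=> _; case: j => [|j]; rewrite ?ltn0 ?andbF.
case: i j => [|i] [|j] //= /andP[x0 s0] ij.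
  rewrite zsum0 zsum_cons1; case: j ij => [|j] ij.
    by rewrite take0 zsum0 addr0.
  by have := IHs 0%N j.+1 s0 ij; rewrite take0 zsum0 /=; lia.
by rewrite !zsum_cons1 ltrD2l IHs.
Qed.

Lemma zsum_take_neq (s : seq zdic) i j : all (fun x : zdic => 0 < x.1) s ->
  (i < j <= size s)%N -> zsum (take i s) <> zsum (take j s).
Proof. by move=> s0 /(zsum_take_lt s0) + e; rewrite e ltxx. Qed.

(** The element placed farthest from the peak on the side with the larger total,
    here [P], is chosen so that the totals of the rest differ, and the rest is
    ordered by induction.  The only sum that contains this element is that of all
    of [P], which no proper part of [N] reaches. *)
Lemma peak_order (z : zdic) (P N : seq zdic) :
  z.1 = 0 -> uniq P -> uniq N ->
  all (fun x : zdic => 0 < x.1) P -> all (fun x : zdic => 0 < x.1) N ->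
  exists P' N' : seq zdic, [/\ perm_eq P' P, perm_eq N' N &
    forall i j, (i <= size P)%N -> (j <= size N)%N ->
      (0 < i + j < size P + size N)%N ->
      zsum (take i P') + z <> zsum (take j N')].
Proof.
have [n] := ubnP (size P + size N); elim: n P N z => // n IHn.
move=> P N z ltn z0 uP uN P0 N0.
wlog lePN : P N z ltn z0 uP uN P0 N0 /
    (zsum N).1 <= (zsum P).1.
  move=> th; case/orP: (le_total (zsum N).1 (zsum P).1) => le.
    exact: th.
  have [|||||||N' [P' [pN pP h]]] := th N P (- z) => //.
  - by rewrite addnC.
  - by rewrite /= z0 oppr0.
  exists P', N'; split=> // i j iP jN ij e; apply: (h j i) => //.
    by rewrite addnC [(size N + _)%N]addnC.
  by rewrite -e addrK.
have [eN|N1] := posnP (size N).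
  exists P, N; split=> // i j iP jN; rewrite eN addn0.
  have -> : take j N = [::] by move: jN; rewrite eN (size0nil eN).
  rewrite zsum0 => ij e.
  have i0 : (0 < i <= size P)%N by lia.
  have := zsum_take_lt P0 i0; rewrite take0 zsum0.
  by have := congr1 fst e; rewrite /= z0 addr0 => ->; rewrite ltxx.
have N1' : 0 < (zsum N).1.
  have := @zsum_take_lt N 0 (size N) N0; rewrite take0 take_size zsum0 N1 leqnn.
  exact.
(* Two distinct elements of [P] cannot both leave a rest of the forbidden total;
   if [P] is a singleton the rest is empty, and [N] has a positive total. *)
have [p [R [pR pz]]] : exists (p : zdic) (R : seq zdic),
    perm_eq (p :: R) P /\ zsum R + z <> zsum N.
  case: P uP P0 {ltn} lePN => [|p [|q P]] uP P0 lePN.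
  - by move: lePN; rewrite zsum0 leNgt N1'.
  - exists p, [::]; split=> //; rewrite zsum0 add0r => e.
    by move: N1'; rewrite -e z0.
  have [e|/eqP ne] := eqVneq (zsum (q :: P) + z) (zsum N); last first.
    by exists p, (q :: P).
  exists q, (p :: P); split; first by apply/seq.permP=> a /=; lia.
  rewrite -e !zsum_cons => /addIr /addIr epq.
  by move: uP; rewrite /= epq !inE eqxx.
have szP : (size R).+1 = size P := perm_size pR.
have uR : uniq R by move: uP; rewrite -(perm_uniq pR) => /andP[].
have R0 : all (fun x : zdic => 0 < x.1) R.
  by move: P0; rewrite -(perm_all _ pR) => /andP[].
have [|P' [N' [pP' pN' h]]] := IHn R N z _ z0 uR uN R0 N0; first by lia.
have sP' : size P' = size R := perm_size pP'.
have sN' : size N' = size N := perm_size pN'.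
have pPP : perm_eq (rcons P' p) P.
  by rewrite perm_rcons (perm_trans _ pR) // perm_cons.
exists (rcons P' p), N'; split=> //.
move=> i j iP jN ij.
case: (ltngtP i (size P)) iP => // [iP _|iP _].
  have iP' : (i <= size P')%N by rewrite sP' -ltnS szP.
  rewrite -cats1 takel_cat //.
  have [ij'|ij'] := ltnP (i + j) (size R + size N).
    by case/andP: ij => ij0 _; apply: h; rewrite // ?ij0 // -sP'.
  have [-> ->] : i = size P' /\ j = size N'.
    by rewrite sP' sN'; clear -iP iP' jN ij ij' sP' szP; lia.
  by rewrite !take_size (perm_zsum pP') (perm_zsum pN').
rewrite iP -(perm_size pPP) take_size (perm_zsum pPP) /= => e.
have := congr1 fst e; rewrite /= z0 addr0 => e1; move: lePN; rewrite leNgt e1.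
have N'0 : all (fun x : zdic => 0 < x.1) N' by rewrite (perm_all _ pN').
have := @zsum_take_lt N' j (size N') N'0.
by rewrite take_size (perm_zsum pN') => -> //; rewrite sN'; clear -iP jN ij; lia.
Qed.

Lemma zprod_nonflip p t : ~~ flip p -> ~~ has flip t ->
  zprod p t = p + zsum t.
Proof.
elim: t p => [|x t IHt] p pn; first by rewrite zsum0 addr0.
rewrite /= negb_or zsum_cons addrA => /andP[xn tn].
have e : zmul p x = p + x by rewrite /zmul -/(flip p) (negbTE pn).
by rewrite e IHt // -e /flip odd_Z4D -/(flip p) (negbTE pn).
Qed.

(** The order given by [peak_order] is read from the peak outwards on both sides,
    with the negative elements opposed. *)
Lemma nonflips_sequenceable n (P N : seq zdic) :
  (n <= 1)%N -> all nonflip_pos P -> all nonflip_neg N -> uniq P -> uniq N ->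
  exists t, perm_eq t (nseq n ztwo ++ P ++ N) /\ distinct_prods t.
Proof.
move=> n1 Ppos Nneg uP uN.
have pos s : all nonflip_pos s -> all (fun x : zdic => 0 < x.1) s.
  by apply: sub_all => x /andP[].
have Nopp : all nonflip_pos (map -%R N).
  rewrite all_map; apply: sub_all Nneg => x /andP[fx x0].
  rewrite /nonflip_pos /= oppr_gt0 x0 andbT.
  by case: x fx {x0} => a e; rewrite /flip /= => /even_Z4P[]->.
have z0 : (ztwo *+ n).1 = 0 by case: n n1 => [|[|]].
have uoN : uniq (map -%R N) by rewrite map_inj_uniq //; apply: oppr_inj.
have [P' [N' [pP pN h]]] := peak_order z0 uP uoN (pos _ Ppos) (pos _ Nopp).
have pPos := pos _ Ppos; rewrite -(perm_all _ pP) in pPos.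
have nPos := pos _ Nopp; rewrite -(perm_all _ pN) in nPos.
rewrite -(perm_size pP) -(perm_size pN) in h.
pose t := rev P' ++ nseq n ztwo ++ map -%R N'.
have pt : perm_eq t (nseq n ztwo ++ P ++ N).
  rewrite /t perm_catCA perm_cat2l; apply: perm_cat; first by rewrite perm_rev.
  by rewrite -(mapK (@opprK _) N) perm_map.
have ft : ~~ has flip t.
  rewrite (perm_has _ pt) !has_cat !negb_or has_nseq /= andbF /=.
  rewrite -!all_predC; apply/andP; split; [apply: sub_all Ppos | apply: sub_all Nneg];
  by move=> x /andP[].
have tk k : zprod 0 (take k t) = zsum (take k t).
  rewrite zprod_nonflip ?add0r //; apply: contra ft => /hasP[x /mem_take xt fx].
  by apply/hasP; exists x.
exists t; split=> // i j; rewrite !tk => ij nij.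
have st : size t = (size P' + (n + size N'))%N by rewrite !size_cat size_rev size_nseq size_map.
have up k : (k <= size P')%N ->
   zsum (take k t) = zsum P' - zsum (take (size P' - k) P').
  move=> kP; rewrite /t takel_cat ?size_rev // take_rev.
  rewrite zsum_rev.
  by apply/(canRL (addrK _)); rewrite addrC -zsum_cat cat_take_drop.
have down k : (size P' + n <= k)%N ->
   zsum (take k t) = zsum P' + ztwo *+ n
     - zsum (take (k - (size P' + n)) N').
  move=> kP; rewrite /t catA take_cat size_cat size_rev size_nseq ltnNge kP /=.
  rewrite 2!zsum_cat zsum_rev.
  rewrite -map_take {2 3}/zsum big_nseq big_map sumrN; congr (_ + _ - _).
  by elim: (n) => //= q ->; rewrite mulrS.
have {st} [i_j jn nij0] : [/\ (i < j)%N, (j <= size P' + (n + size N'))%N &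
    (0 < i)%N || (j < size P' + (n + size N'))%N].
  move: ij nij; rewrite xpair_eqE st negb_and -lt0n => /andP[i_j jn].
  by rewrite [(j < _)%N]ltn_neqAle jn andbT.
have jP' : (size P' < j)%N -> (size P' + n <= j)%N by clear -n1; lia.
case: (leqP j (size P')) => [jP|jP].
  rewrite !up // ?(leq_trans (ltnW i_j)) // => /addrI /oppr_inj /esym.
  by apply: zsum_take_neq => //; clear -i_j jP; lia.
case: (leqP i (size P')) => [iP|iP]; last first.
  have iP' : (size P' + n <= i)%N by clear -n1 iP; lia.
  rewrite !down ?jP' // => /addrI /oppr_inj; apply: zsum_take_neq => //.
  by clear -i_j jn iP'; lia.
rewrite up // down ?jP' // -addrA => /addrI e.
have e' : zsum (take (size P' - i) P') + ztwo *+ n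
        = zsum (take (j - (size P' + n)) N').
  by apply/eqP; rewrite -subr_eq0 -addrA -e addrN.
case: (posnP ((size P' - i) + (j - (size P' + n)))) => [ij0|ij0]; last first.
  apply: h e' => //; first by rewrite leq_subr.
    by rewrite leq_subLR -addnA.
  rewrite ij0 /=; move: n1 jn jP iP nij0; clear.
  by move: (size P') (size N') => p q; lia.
have [i0 j0] : (size P' - i = 0 /\ j - (size P' + n) = 0)%N by clear -ij0; lia.
move: e'; rewrite i0 j0 !take0 !zsum0 add0r.
have {ij0} n0 : (0 < n)%N by clear -i0 j0 i_j; lia.
by clear -n1 n0; case: n n1 n0 => [|[|]].
Qed.

(** * Sequencing finite subsets of Z : Z/4 *)

Lemma perm_classes (s : seq zdic) : 0 \notin s ->
  perm_eq (nseq (count_mem ztwo s) ztwo ++ filter nonflip_pos s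
             ++ filter nonflip_neg s ++ filter flip s) s.
Proof.
move=> s0; apply/seq.permP=> q; rewrite !count_cat count_nseq.
elim: s s0 => [|x s IHs] /=; first by rewrite muln0.
rewrite inE negb_or => /andP[x0 /IHs <-] {IHs}.
rewrite /nonflip_pos /nonflip_neg.
case fx: (flip x) => /=; first by case: (x =P ztwo) fx => [->|_ _] //=; lia.
case: (ltgtP (x.1 : int) 0) => x1 /=.
- by case: (x =P ztwo) x1 => [->|_ _] //=; lia.
- by case: (x =P ztwo) x1 => [->|_ _] //=; lia.
have -> : x = ztwo; last by rewrite eqxx mulnDr muln1 !addnA.
case: x x1 x0 fx => [x e] /= -> e0 /negbT /even_Z4P /= [] e1; last by rewrite e1.
by case/eqP: e0; rewrite e1.
Qed.

Theorem zdic_sequenceable (s : seq zdic) : uniq s -> 0 \notin s ->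
  exists t, perm_eq t s /\ distinct_prods t.
Proof.
move=> us s0; have ps := perm_classes s0; set n := count_mem _ _ in ps.
have n1 : (n <= 1)%N by rewrite /n count_uniq_mem // leq_b1.
have Ppos := filter_all nonflip_pos s; have Nneg := filter_all nonflip_neg s.
have [F0|F0] := posnP (size (filter flip s)).
  have [t [pt gt]] := nonflips_sequenceable n1 Ppos Nneg (filter_uniq _ us) (filter_uniq _ us).
  exists t; split=> //; apply: perm_trans pt _.
  by rewrite (size0nil F0) cats0 in ps.
have [t [pt gt]] := flips_sequenceable n1 Ppos Nneg (filter_all _ _) (filter_uniq _ us) F0.
by exists t; split=> //; apply: perm_trans pt _.
Qed.

(** * Rectification *)

(** Dirichlet's simultaneous approximation: two of the [#|S| ^ #|S| + 1]
    multipliers [l] put all [l * a x] modulo [m] in the same boxes of width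
    [m / #|S|], and their difference is positive and smaller than every prime
    factor of [m]. *)
Lemma dilation (T : finType) (S : {set T}) (a : T -> nat) m :
  (0 < m)%N -> (0 < #|S|)%N ->
  (forall p, prime p -> (p %| m)%N -> (#|S| ^ #|S| < p)%N) ->
  exists lam (y : T -> int), coprime lam m /\ forall x, x \in S ->
    (m%:Z %| y x - (lam * a x)%:Z)%Z /\ - m%:Z < y x * #|S|%:Z < m%:Z.
Proof.
move=> m0 + hp; case k0 : #|S| => [//|k] _.
pose u l x := ((l * a x) %% m)%N.
pose f (l : 'I_(k.+1 ^ k.+1).+1) : {ffun T -> 'I_k.+1} :=
  [ffun x => if x \in S then inord (u l x * k.+1 %/ m) else ord0].
have : ~~ injectiveb f.
  apply/injectiveP=> fI; have := card_codom fI; rewrite card_ord => cf.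
  have : (#|codom f| <= #|pffun_on (@ord0 k) (mem S) (mem 'I_k.+1)|)%N.
    apply/subset_leq_card/subsetP=> _ /codomP[l ->]; apply/pffun_onP; split=> //.
    by apply/subsetP=> x; rewrite !inE ffunE; case: ifP; rewrite ?eqxx.
  by rewrite cf card_pffun_on card_ord k0 ltnn.
case/injectivePn=> l1 [l2 + eqf]; wlog lt21 : l1 l2 eqf / (l2 < l1)%N.
  move=> th ne; case: (ltngtP l2 l1) => [lt|lt|/val_inj eq].
  - exact: (th l1 l2).
  - by apply: (th l2 l1) => //; rewrite eq_sym.
  - by rewrite eq eqxx in ne.
move=> _; exists (l1 - l2)%N, (fun x => (u l1 x)%:Z - (u l2 x)%:Z); split.
  have lam0 : (0 < l1 - l2)%N by rewrite subn_gt0.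
  rewrite coprime_has_primes //; apply/hasPn=> p; rewrite !mem_primes.
  case/and3P=> pp _ /(hp p pp); rewrite k0 pp lam0 /= => ltp.
  apply/negP=> /(dvdn_leq lam0); apply/negP; rewrite -ltnNge.
  by apply: leq_trans ltp; apply: leq_ltn_trans (leq_subr _ _) (ltn_ord l1).
move=> x xS; split.
  have e l : (u l x)%:Z = (l * a x)%:Z - ((l * a x) %/ m)%:Z * m%:Z.
    by rewrite /u {2}(divn_eq (l * a x) m) PoszD PoszM addrC addKr.
  rewrite !e mulnBl -subzn ?leq_mul2r ?(ltnW lt21) ?orbT //.
  suff dvd (A B c d : int) : (m%:Z %| A - c * m%:Z - (B - d * m%:Z) - (A - B))%Z.
    exact: dvd.
  have -> : A - c * m%:Z - (B - d * m%:Z) - (A - B) = (d - c) * m%:Z by lia.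
  by rewrite dvdz_mull.
have := congr1 (fun g : {ffun T -> 'I_k.+1} => val (g x)) eqf.
have floor l : (u l x * k.+1 %/ m < k.+1)%N.
  by rewrite ltn_divLR // mulnC ltn_pmul2l // ltn_mod.
rewrite /= !ffunE xS !inordK //; move: (u l1 x) (u l2 x) => v1 v2 eq12.
have := divn_eq (v1 * k.+1) m; have := divn_eq (v2 * k.+1) m; rewrite eq12.
have := ltn_pmod (v1 * k.+1) m0; have := ltn_pmod (v2 * k.+1) m0.
rewrite mulrBl -!PoszM; move: (v1 * _)%N (v2 * _)%N => A B.
by move: (_ * m)%N (A %% m)%N (B %% m)%N; lia.
Qed.

(** * Lifting the dicyclic group to Z : Z/4 *)

Section Lift.

Variables m lam : nat.
Hypothesis odd_m : odd m.

Let m0 : (0 < m)%N. Proof. by case: m odd_m. Qed.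

Let m2 : (Zp_trunc m.*2).+2 = m.*2.
Proof. by rewrite Zp_cast // -addnn; case: m m0 => // n _; rewrite addnS. Qed.

Lemma Zp_addE (u v : 'Z_(m.*2)) : exists e, (u + v = (u + v)%R + e * m.*2)%N.
Proof.
exists ((u + v) %/ (Zp_trunc m.*2).+2)%N.
by rewrite /= -[X in (_ + _ * X)%N]m2 [RHS]addnC -divn_eq.
Qed.

(** The restriction to [<[r]>] of the morphism onto [Z/4] that maps [r] to 2 and
    [s] to 1; it exists because [m] is odd, so that [r ^+ m] and [s ^+ 2] both
    have image 2. *)
Definition quarter (u : 'Z_(m.*2)) : 'Z_4 := (2 * u)%:R.

Lemma quarterD u v : quarter (u + v) = quarter u + quarter v.
Proof.
have [e E] := Zp_addE u v; rewrite /quarter -natrD -mulnDr E mulnDr natrD.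
rewrite -[LHS]addr0; congr (_ + _).
have -> : (2 * (e * m.*2) = (e * m) * 4)%N by lia.
by rewrite natrM pchar_Zp // mulr0.
Qed.

Lemma quarterN u : quarter (- u) = quarter u.
Proof.
have q2 : quarter u + quarter u = 0.
  rewrite -natrD (_ : (_ + _ = u * 4)%N); last by lia.
  by rewrite natrM pchar_Zp // mulr0.
by apply: (addIr (quarter u)); rewrite q2 -quarterD addNr /quarter muln0.
Qed.

Lemma val_m : (m%:R : 'Z_(m.*2)) = m :> nat.
Proof.
have p1 : (1 < m.*2)%N by rewrite -m2.
by rewrite val_Zp_nat // modn_small // -addnn -[X in (X < _)%N]addn0 ltn_add2l.
Qed.

Lemma quarter_m : quarter m%:R = 2%:R.
Proof.
rewrite /quarter val_m; have -> : (2 * m = m./2 * 4 + 2)%N by lia.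
by rewrite natrD natrM pchar_Zp // mulr0 add0r.
Qed.

Lemma even_quarter u : odd (quarter u) = false.
Proof. by rewrite /quarter val_Zp_nat // odd_mod // mul2n odd_double. Qed.

(** [q] represents the image of [g] in [Z/m : Z/4], with the [Z/m] coordinate
    multiplied by [lam]. *)
Definition lifts (g : dic_model m) (q : zdic) : Prop :=
  (m%:Z %| q.1 - (lam * g.1)%:Z)%Z /\ q.2 = quarter g.1 + (nat_of_bool g.2)%:R.

Lemma lifts_flip g q : lifts g q -> flip q = g.2.
Proof. by case=> _; rewrite /flip => ->; rewrite odd_Z4D even_quarter; case: (g.2). Qed.

Lemma lifts1 : lifts 1%g 0.
Proof.
have -> : (1%g : dic_model m) = (0, false) by [].
by split; rewrite /= ?muln0 ?subrr ?dvdz0 // /quarter muln0 addr0.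
Qed.

Lemma dvd_addE (u v : 'Z_(m.*2)) : (m%:Z %| u%:Z + v%:Z - (u + v)%R%:Z)%Z.
Proof.
have [e E] := Zp_addE u v.
have -> : u%:Z + v%:Z - (u + v)%R%:Z = (e * 2)%:Z * m%:Z by lia.
by rewrite dvdz_mull.
Qed.

Lemma dvd_oppE (u : 'Z_(m.*2)) : (m%:Z %| u%:Z + (- u)%R%:Z)%Z.
Proof. by have := dvd_addE u (- u); rewrite addrN subr0. Qed.

Lemma lifts_mul g h p q : lifts g p -> lifts h q -> lifts (g * h)%g (zmul p q).
Proof.
move=> gp; have fp := lifts_flip gp; case: gp => p1 p2 [q1 q2].
rewrite /lifts /zmul /= -/(flip p) fp p2 q2 {p2 q2}.
case: g h p1 q1 fp => [g a] [h b] /= p1 q1 fp; split; last first.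
  have Q : quarter (if a && b then m%:R else 0) + (nat_of_bool (a (+) b))%:R
         = (nat_of_bool a)%:R + (nat_of_bool b)%:R.
    rewrite (fun_if quarter) quarter_m [in quarter 0]/quarter muln0.
    by case: (a); case: (b); apply: val_inj.
  by rewrite !quarterD -(addrA (_ + _)) Q (fun_if quarter) quarterN if_same addrACA.
set Y : 'Z_(m.*2) := (g + (if a then - h else h)
                        + (if a && b then m%:R else 0))%R.
change (m%:Z %| p.1 + (if a then - q.1 else q.1) - (lam * Y)%N%:Z)%Z.
have [d E] : exists d : int, Y%:Z
   = g%:Z + (if a then - h%:Z else h%:Z) + d * m%:Z.
  rewrite /Y; set s := (if a then - h else h); set c := (if _ then _ else 0).
  have /dvdzP[d1 e1] := dvd_addE g s; have /dvdzP[d2 e2] := dvd_addE (g + s) c.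
  have [d3 e3] : exists d3 : int, c%:Z = d3 * m%:Z.
    rewrite /c; case: ifP => _; last by exists 0; rewrite mul0r.
    by exists 1; rewrite mul1r val_m.
  have [d4 e4] : exists d4 : int, s%:Z = (if a then - h%:Z else h%:Z) + d4 * m%:Z.
    rewrite /s; case: (a); last by exists 0; rewrite mul0r addr0.
    by have /dvdzP[d4 e4] := dvd_oppE h; exists d4; rewrite -e4 addKr.
  exists (d3 + d4 - d1 - d2); rewrite !mulrBl mulrDl -e1 -e2 -e3; lia.
case/dvdzP: p1 => d1 e1; case/dvdzP: q1 => d2 e2.
apply/dvdzP; exists (d1 + (if a then - d2 else d2) - lam%:Z * d).
rewrite PoszM E mulrBl mulrDl -e1 -mulrA.
have -> : (if a then - d2 else d2) * m%:Z = (if a then - (d2 * m%:Z) else d2 * m%:Z).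
  by case: (a); rewrite // mulNr.
by rewrite -e2; case: (a); lia.
Qed.

Lemma lifts_eq g p q : lifts g p -> lifts g q ->
  p.2 = q.2 /\ (m%:Z %| p.1 - q.1)%Z.
Proof.
case=> p1 p2 [q1 q2]; split; first by rewrite p2 q2.
by have := rpredB p1 q1; rewrite opprB addrA subrK.
Qed.

Hypothesis lam_m : coprime lam m.

(** [lam] is invertible modulo [m], and the class in [Z/4] determines both the
    power of [s] and the parity of the power of [r]; with [m] odd, this is the
    exponent of [r] modulo [2m]. *)
Lemma lifts_inj g h q : lifts g q -> lifts h q -> g = h.
Proof.
move=> gq hq; have := lifts_flip gq; rewrite (lifts_flip hq).
case: gq hq => [g1 g2] [h1 h2].
case: g h g1 g2 h1 h2 => [g a] [h b] /= g1 g2 h1 h2 ab; congr (_, _) => //.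
have {g2 h2} : nat_of_ord (quarter g) = quarter h.
  by congr nat_of_ord; apply: (addIr (nat_of_bool a)%:R); rewrite -g2 h2 ab.
rewrite /quarter !val_Zp_nat // => /eqP e4.
have {g1 h1} : (m%:Z %| lam%:Z * (g%:Z - h%:Z))%Z.
  by have := rpredB h1 g1; rewrite mulrBr !PoszM opprB addrC addrA subrK addrC.
rewrite Gauss_dvdzr; last by rewrite coprimezE coprime_sym.
move=> dm; have d2 : (2 %| g%:Z - h%:Z)%Z.
  by move: e4; move: (nat_of_ord g) (nat_of_ord h) => x y; clear; lia.
have c2m : coprimez 2 m%:Z by rewrite coprimezE /= coprime2n.
have gm : (g < m.*2)%N by rewrite -[X in (_ < X)%N]m2.
have hm : (h < m.*2)%N by rewrite -[X in (_ < X)%N]m2.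
have := Gauss_dvdz (g%:Z - h%:Z) c2m; rewrite d2 dm dvdzE.
move=> /(@dvdn_leq _ _) le; apply: val_inj => /=.
move: le gm hm; move: (nat_of_ord g) (nat_of_ord h) => x y; clear; lia.
Qed.
End Lift.

(** * Transfer to the dicyclic group *)

(** [size t] increments of absolute value at most [(m - 1) / k]. *)
Lemma zprod_bound (m k : nat) p (t : seq zdic) :
  (0 < k)%N -> (0 < m)%N -> (size t <= k)%N ->
  all (fun x : zdic => - m%:Z < x.1 * k%:Z < m%:Z) t ->
  `|(zprod p t).1 - p.1| < m%:Z.
Proof.
move=> k0 m0 tk tm.
have step : `|(zprod p t).1 - p.1| * k%:Z <= (size t)%:Z * (m%:Z - 1).
  elim: t p tm {tk} => [|x t IHt] p /=; first by rewrite subrr normr0 !mul0r.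
  case/andP=> xm /(IHt (zmul p x)) {IHt}; set q := zprod _ t => le.
  have dx : `|x.1| * k%:Z <= m%:Z - 1.
    rewrite -[X in _ * X](@ger0_norm _ k%:Z) // -normrM.
    by move: (_ * _) xm => z; clear; lia.
  have tri : `|q.1 - p.1| <= `|q.1 - (zmul p x).1| + `|x.1|.
    have -> : `|x.1| = `|(zmul p x).1 - p.1|.
      by rewrite /zmul addrAC subrr add0r; case: ifP; rewrite ?normrN.
    by apply: le_trans (ler_normD _ _); rewrite addrA subrK.
  have k0' : 0 <= k%:Z by [].
  apply: le_trans (ler_wpM2r k0' tri) _; rewrite mulrDl.
  apply: le_trans (lerD le dx) _.
  by rewrite -[(size t).+1]addn1 PoszD mulrDl mul1r.
have kz : 0 < k%:Z by rewrite ltz_nat.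
rewrite -(ltr_pM2r kz); apply: le_lt_trans step _.
apply: (@le_lt_trans _ _ (k%:Z * (m%:Z - 1))).
  by apply: ler_wpM2r; [clear -m0; lia | rewrite lez_nat].
by rewrite mulrC (ltr_pM2r kz); clear; lia.
Qed.

Lemma lifts_prod m lam (gT : finGroupType) (G : {group gT})
    (f : {morphism G >-> dic_model m}) (w : gT -> zdic) (l : seq gT) g p :
  odd m -> (forall x, x \in l -> x \in G /\ lifts lam (f x) (w x)) ->
  lifts lam g p ->
  lifts lam (g * f (\prod_(x <- l) x))%g (zprod p (map w l)).
Proof.
move=> om; elim: l g p => [|x l IHl] g p lw gp.
  by rewrite big_nil morph1 mulg1.
have [xG fx] := lw x (mem_head _ _).
have lw' y : y \in l -> y \in G /\ lifts lam (f y) (w y).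
  by move=> yl; apply: lw; rewrite inE yl orbT.
rewrite big_cons morphM //; last first.
  by rewrite big_seq; apply: group_prod => y /lw' [].
by rewrite mulgA /=; apply: IHl => //; apply: lifts_mul.
Qed.

Lemma sequenceable1 (gT : finGroupType) (S : {set gT}) : #|S| = 1%N -> sequenceable S.
Proof.
move/eqP/cards1P=> [x ->]; exists [:: x]; split=> //.
  by move=> y; rewrite !inE.
by case=> [|i] [|[|j]] //=; rewrite ?andbF.
Qed.

Theorem theorem3p10 (m k : nat) (gT : finGroupType) (G : {group gT})
    (S : {set gT}) :
  (1 <= m)%N -> (1 <= k)%N ->
  (forall p : nat, prime p -> (p %| m)%N -> (k ^ k < p)%N) ->
  dicyclic m G ->
  S \subset (G :\ 1)%g -> #|S| = k ->
  sequenceable S.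
Proof.
move=> m0 k0 hp dicG SG Sk.
have [k1|k1] := leqP k 1.
  by apply: sequenceable1; rewrite Sk; apply/eqP; rewrite eqn_leq k1.
have odd_m : odd m.
  rewrite -[odd m]negbK -dvdn2; apply/negP=> /(hp 2 isT).
  rewrite ltnNge => /negP[]; apply: leq_trans k1 _.
  by have := leq_pexp2l k0 k0; rewrite expn1.
(* Both groups satisfy the universal property of the presentation. *)
have : G \isog [set: dic_model m].
  have dicD := dic_model_dicyclic m0.
  by rewrite isogEhom (dicD _ G) (dicG _ [set: dic_model m]%G) !isoGrp_hom.
case/isogP=> f injf _.
have SG' x : x \in S -> x \in G /\ x != 1%g.
  by move=> /(subsetP SG); rewrite !inE => /andP[].
rewrite -Sk in k0 k1 hp.
have [lam [y [lam_m hy]]] := dilation (fun x => nat_of_ord (f x).1) m0 k0 hp.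
pose w x : zdic := (y x, quarter (f x).1 + (nat_of_bool (f x).2)%:R).
have fw x : x \in S -> lifts lam (f x) (w x) by move=> /hy[].
have winj : {in S &, injective w}.
  move=> x x' xS x'S eqw; have [xG _] := SG' x xS; have [x'G _] := SG' x' x'S.
  apply: (injmP injf) => //; apply: (lifts_inj odd_m lam_m (fw x xS)).
  by rewrite eqw; apply: fw.
pose s := map w (enum S).
have us : uniq s.
  by rewrite map_inj_in_uniq ?enum_uniq // => a b; rewrite !mem_enum; apply: winj.
have s0 : 0 \notin s.
  apply/mapP=> -[x]; rewrite mem_enum => xS w0; have [xG] := SG' x xS.
  case/eqP; apply: (injmP injf) => //; rewrite morph1.
  by apply: (lifts_inj odd_m lam_m (fw x xS)); rewrite -w0; apply: lifts1.
have [t [pt gt]] := zdic_sequenceable us s0.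
have [Is pIs et] := perm_iotaP 0 pt.
(* The ordering [t] of the lifts comes from an ordering [l] of [S]. *)
pose l := map (nth 1%g (enum S)) Is.
have pl : perm_eq l (enum S).
  have := perm_map (nth 1%g (enum S)) pIs; rewrite size_map map_nth_iota0 //.
  by rewrite take_size.
have etl : t = map w l.
  rewrite et -map_comp; apply/eq_in_map=> i; rewrite (perm_mem pIs) mem_iota.
  by rewrite size_map => /= lti; rewrite (nth_map 1%g).
have lS x : (x \in l) = (x \in S) by rewrite (perm_mem pl) mem_enum.
exists l; split; [by rewrite (perm_uniq pl) enum_uniq | exact: lS |].
have szt : size t = size l by rewrite etl size_map.
have szl : size l = #|S| by rewrite (perm_size pl) cardE.
move=> i j ij nij eqij; apply: (gt i j); rewrite ?szt //.
have lift n : lifts lam (f (partial_prod l n)) (zprod 0 (take n t)).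
  rewrite etl -map_take -[f _]mul1g; apply: lifts_prod => //; last exact: lifts1.
  by move=> x /mem_take; rewrite lS => xS; split; [case: (SG' x xS) | apply: fw].
have := lift j; rewrite -eqij => lj; have [e2 /dvdzP[d e1]] := lifts_eq lj (lift i).
have [ij1 jl] := andP ij.
have ej : zprod 0 (take j t) = zprod (zprod 0 (take i t)) (drop i (take j t)).
  rewrite -{1}(cat_take_drop i (take j t)) /zprod foldl_cat.
  by rewrite take_takel // ltnW.
have bnd : `|(zprod 0 (take j t)).1 - (zprod 0 (take i t)).1| < m%:Z.
  rewrite ej; apply: (@zprod_bound m #|S| _ _ k0 m0).
    by rewrite size_drop -szl -szt (leq_trans (leq_subr _ _)) // size_take_min geq_minr.
  apply/allP=> q /mem_drop /mem_take; rewrite etl => /mapP[x]; rewrite lS => xS ->.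
  by case: (hy x xS).
(* The difference is a multiple of [m] of absolute value less than [m]. *)
have d0 : d = 0.
  move: bnd; rewrite e1 normrM -[X in _ < X]mul1r ltr_pM2r ?ltz_nat //.
  by clear; lia.
rewrite [LHS]surjective_pairing [RHS]surjective_pairing e2; congr (_, _).
by apply/esym/eqP; rewrite -subr_eq0 e1 d0 mul0r.
Qed.
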